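(* Let a positive integer $k$ be given. (a) The number $c^k_{12}(n)$ of $k$-compositions of $n$ whose positive parts are all $1$ or $2$ satisfies $c^k_{12}(1)=1$, $c^k_{12}(2)=k+1$, and $c^k_{12}(n)=k\,c^k_{12}(n-1)+k\,c^k_{12}(n-2)$ for $n\ge 3$. (b) The number $c^k_{\text{odd}}(n)$ of $k$-compositions of $n$ whose positive parts are all odd satisfies $c^k_{\text{odd}}(1)=1$, $c^k_{\text{odd}}(2)=k$, and $c^k_{\text{odd}}(n)=k\,c^k_{\text{odd}}(n-1)+c^k_{\text{odd}}(n-2)$ for $n\ge 3$. (c) The number $c^k_{\hat 1}(n)$ of $k$-compositions of $n$ with no parts equal to $1$ satisfies $c^k_{\hat 1}(2)=1$, $c^k_{\hat 1}(3)=1$, and $c^k_{\hat 1}(n)=c^k_{\hat 1}(n-1)+k\,c^k_{\hat 1}(n-2)$ for $n\ge 4$.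
   Context: A composition of a positive integer $n$ is a finite ordered sequence of positive integers (parts) with sum $n$. For a positive integer $k$, a $k$-composition of $n$ is a composition of $n$ with either of the following equivalent modifications. (a) Colored parts: each part is assigned a color in $\{1,\dots,k\}$, except that the first part must have color 1. (b) Internal zeros: each (positive) part except the first may be immediately preceded by up to $k-1$ zeros. The two versions correspond by replacing each colored part $c_\ell$ with $\ell-1$ zeros followed by $c$. The part restrictions concern only the values of positive parts; zeros permitted by version (b) (equivalently, arbitrary permitted colors in version (a)) are allowed. *)

(* Defs.v *)
From mathcomp Require Import all_boot.

Set Implicit Arguments.
Unset Strict Implicit.
Unset Printing Implicit Defensive.

(* A colored composition is a sequence of pairs (part, color); the colors are
   1, ..., k and the first part must have color 1. *)
Definition kcomposition (k n : nat) (s : seq (nat * nat)) : bool :=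
  [&& all (fun c => 0 < c) (unzip1 s),
      sumn (unzip1 s) == n,
      all (fun l => 0 < l <= k) (unzip2 s)
    & head 1 (unzip2 s) == 1].

Definition uncode (n k : nat) (x : 'I_n.+1 * 'I_k.+1) : nat * nat :=
  (val x.1, val x.2).

(* The number of k-compositions of n all of whose parts satisfy p. Such a
   composition has at most n parts, each at most n, so it is enough to count
   in a finite type of bounded sequences; see [kcountP]. *)
Definition kcount (p : pred nat) (k n : nat) : nat :=
  #|[set t : {bseq n of 'I_n.+1 * 'I_k.+1} |
      let s := map (@uncode n k) t in
      kcomposition k n s && all p (unzip1 s)]|.

Definition c12 : nat -> nat -> nat := kcount (fun c => (c == 1) || (c == 2)).
Definition codd : nat -> nat -> nat := kcount odd.
Definition cno1 : nat -> nat -> nat := kcount (fun c => c != 1).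

Lemma uncode_inj n k : injective (@uncode n k).
Proof. by move=> [a b] [c d] [] /val_inj -> /val_inj ->. Qed.

(* The bounds used in [kcount] lose nothing: it is the length of any
   duplicate-free list of all the restricted k-compositions of n. *)
Lemma kcountP (p : pred nat) (k n : nat) (e : seq (seq (nat * nat))) :
    uniq e ->
    (forall s, (s \in e) = kcomposition k n s && all p (unzip1 s)) ->
  kcount p k n = size e.
Proof.
move=> Ue He; rewrite /kcount cardE.
set A := finset _.
pose f (t : {bseq n of 'I_n.+1 * 'I_k.+1}) := map (@uncode n k) t.
have finj : injective f.
  by move=> t u /(inj_map (@uncode_inj n k)) /val_inj.
rewrite -(size_map f); apply/perm_size/uniq_perm => //.
  by rewrite (map_inj_uniq finj) enum_uniq.
move=> s; rewrite He; apply/mapP/idP => [[t]|Hs].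
  by rewrite mem_enum inE => Ht ->.
have [/and4P[pos /eqP sn col _] _] := andP Hs.
have szle (r : seq nat) : all (fun c => 0 < c) r -> size r <= sumn r.
  by elim: r => //= a r IH /andP[a0 /IH]; rewrite -add1n; apply: leq_add.
have mle (r : seq nat) a : a \in r -> a <= sumn r.
  elim: r => //= b r IH; rewrite inE => /orP[/eqP->|/IH h]; first exact: leq_addr.
  by apply: leq_trans h _; exact: leq_addl.
have szs : size s <= n by rewrite -sn -(size_map fst); exact: szle.
pose g (x : nat * nat) : 'I_n.+1 * 'I_k.+1 := (inord x.1, inord x.2).
have szg : size (map g s) <= n by rewrite size_map.
have fg : f (Bseq szg) = s.
  rewrite /f /= -map_comp -[RHS]map_id; apply/eq_in_map => -[a b] ab /=.
  have ha : a <= n by rewrite -sn; apply/mle/mapP; exists (a, b).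
  have hb : b <= k.
    by have /allP/(_ b)/(_ _)/andP[] := col => //; apply/mapP; exists (a, b).
  by rewrite /uncode /= !inordK.
by exists (Bseq szg); rewrite ?fg // mem_enum inE -/(f _) fg.
Qed.

(* Main.v *)
Require Import Defs.
From mathcomp Require Import all_boot.

(** Deleting the last part of a [k]-composition of [n] with at least two parts
    leaves a [k]-composition of [n - a], where [a] is the deleted value, and the
    deleted part had any of the [k] colors. A composition with a single part is
    [n] itself, necessarily of color 1. Hence, for any set [p] of allowed parts,
    the number [c n] of [k]-compositions satisfies for [n > 0]
      [c n = p n + k * \sum_(1 <= a < n | p a) c (n - a)]
    ([kcount_rec]). All three parts of the theorem follow from this recurrence
    alone. For parts 1 and 2 the sum has two terms. For odd parts, [p n] equals
    [p (n - 2)], so [p n] and the terms with [a >= 3] form, after a shift of [a]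
    by 2, the recurrence for [n - 2]. For parts different from 1 and [n >= 4],
    both [p n] and [p (n - 1)] are 1, so [p n] and the terms with [a >= 3] form,
    after a shift of [a] by 1, the recurrence for [n - 1]. *)

(** The nonemptiness of [s] matters twice: it keeps the color condition on the
    first part inside [s], and it makes the sum of [s] positive, whence [a < n]. *)
Lemma kcomposition_rcons (k n a l : nat) (s : seq (nat * nat)) :
  s != [::] ->
  kcomposition k n (rcons s (a, l)) =
    [&& 0 < a < n, 0 < l <= k & kcomposition k (n - a) s].
Proof.
case: s => // x s _; rewrite /kcomposition /unzip1 /unzip2 !map_rcons.
rewrite !all_rcons sumn_rcons [head _ (rcons _ _)]/= [head _ (map _ _)]/=.
set t := map fst (x :: s); set u := map snd (x :: s); cbn [fst snd].
case pos: (all _ t); last by rewrite !andbF.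
have t_gt0 : 0 < sumn t.
  by move: pos; rewrite /t /= => /andP[x_gt0 _]; rewrite addn_gt0 x_gt0.
have -> : (sumn t + a == n) = (a < n) && (sumn t == n - a).
  apply/eqP/andP => [<-|[lt_an /eqP->]]; last by rewrite subnK // ltnW.
  by rewrite addnK eqxx -[X in X < _]add0n ltn_add2r.
by case: (0 < a); case: (a < n); case: (0 < l <= k); rewrite ?andbF ?andbT.
Qed.

(** The recursion removes the last part. The fuel [m] bounds the number of parts,
    so that for [n > 0] any [m >= n] gives all restricted [k]-compositions. *)
Fixpoint kcomps (p : pred nat) (k m n : nat) : seq (seq (nat * nat)) :=
  if m is m'.+1 then
    nseq (p n) [:: (n, 1)] ++
    [seq rcons s x | x <- [seq (a, l) | a <- [seq a <- index_iota 1 n | p a],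
                                        l <- iota 1 k],
                     s <- kcomps p k m' (n - x.1)]
  else [::].

Lemma mem_kcomps (p : pred nat) (k m n : nat) (s : seq (nat * nat)) :
  0 < k -> 0 < n <= m ->
  (s \in kcomps p k m n) = kcomposition k n s && all p (unzip1 s).
Proof.
move=> k_gt0; elim: m n s => [|m IHm] n s /andP[n_gt0 le_nm].
  by move: n_gt0; rewrite ltnNge le_nm.
rewrite [kcomps _ _ _ _]/= mem_cat mem_nseq.
have IH a r : 0 < a < n -> (r \in kcomps p k m (n - a)) =
    kcomposition k (n - a) r && all p (unzip1 r).
  case/andP=> a_gt0 lt_an; apply: IHm; rewrite subn_gt0 lt_an /=.
  by rewrite leq_subLR (leq_trans le_nm) // -add1n leq_add2r.
apply/orP/idP.
  case=> [/andP[pn /eqP->]|/allpairsPdep[[a l] [r [/allpairsP[[b j] /=]]]]].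
    by rewrite /kcomposition /= addn0 eqxx n_gt0 k_gt0; case: (p n) pn.
  rewrite mem_filter mem_index_iota mem_iota add1n ltnS.
  case=> [/andP[pb b_n]] j_k [-> ->]; rewrite IH // => /andP[rP pr] ->.
  (* The empty sequence is a composition of 0 only, and [n - b > 0]. *)
  have r_neq0 : r != [::].
    apply: contraTneq rP => ->; rewrite /kcomposition /= eq_sym subn_eq0.
    by case/andP: b_n => _; rewrite ltnNge => /negPf->.
  by rewrite kcomposition_rcons // b_n j_k rP /unzip1 map_rcons all_rcons pb.
case/lastP: s => [|r [a l]].
  by rewrite /kcomposition /=; case: n n_gt0 {IH le_nm}.
have [->|r_neq0] := eqVneq r [::].
  rewrite /kcomposition /= addn0 !andbT.
  move=> /andP[/and4P[_ /eqP-> _ /eqP->] ->]; left; exact: eqxx.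
rewrite kcomposition_rcons // /unzip1 map_rcons all_rcons.
case/andP=> /and3P[a_n l_k rP] /andP[pa pr]; right.
apply/allpairsPdep; exists (a, l), r; split; rewrite ?IH ?rP //.
by apply: allpairs_f; rewrite ?mem_filter ?mem_index_iota ?mem_iota ?pa ?add1n.
Qed.

Lemma kcomps_uniq (p : pred nat) (k m n : nat) :
  n <= m -> uniq (kcomps p k m n).
Proof.
elim: m n => [|m IHm] n le_nm //=.
rewrite cat_uniq; apply/and3P; split; first by case: (p n).
  apply/hasPn => s /allpairsPdep[[a l] [r [/allpairsP[[b j] /=]]]].
  rewrite mem_filter mem_index_iota mem_nseq.
  case=> [/andP[_ /andP[_ lt_bn]]] _ [-> _] _ ->.
  apply/negP => /andP[_ /eqP eq_s]; have := congr1 (last (0, 0)) eq_s.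
  by rewrite last_rcons => -[eq_bn]; rewrite eq_bn ltnn in lt_bn.
apply: allpairs_uniq_dep.
- by apply: allpairs_uniq => [||[? ?] [? ?] _ _ /= [-> ->]];
    rewrite ?filter_uniq ?iota_uniq.
- move=> _ /allpairsP[[a l] [/= + _ ->]]; rewrite mem_filter mem_index_iota.
  case/and3P=> _ a_gt0 lt_an; apply: IHm; rewrite leq_subLR.
  by rewrite (leq_trans le_nm) // -add1n leq_add2r.
by move=> [x s] [y t] _ _ /= /rcons_inj[-> ->].
Qed.

Lemma kcount_kcomps (p : pred nat) (k m n : nat) :
  0 < k -> 0 < n <= m -> kcount p k n = size (kcomps p k m n).
Proof.
move=> k_gt0 n_m; apply: kcountP => [|s]; last exact: mem_kcomps.
by apply: kcomps_uniq; case/andP: n_m.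
Qed.

(** The term [p n] is the single part [n] of color 1; the factor [k] is the choice
    of a color for a last part [a < n] that follows a composition of [n - a]. *)
Lemma kcount_rec (p : pred nat) (k n : nat) : 0 < k -> 0 < n ->
  kcount p k n = p n + k * \sum_(1 <= a < n | p a) kcount p k (n - a).
Proof.
move=> k_gt0; case: n => // n _.
rewrite (@kcount_kcomps p k n.+1) ?leqnn //= size_cat size_nseq; congr (_ + _).
rewrite size_allpairs_dep sumnE big_map big_allpairs_dep big_filter big_distrr.
apply: congr_big_nat => // a /andP[_ /andP[a_gt0 lt_an]].
rewrite (eq_bigr (fun=> kcount p k (n.+1 - a))) => [|l _].
  by rewrite big_const_seq count_predT size_iota iter_addn_0 mulnC.
rewrite (@kcount_kcomps p k n) // subn_gt0 lt_an /=.
by rewrite leq_subLR -add1n leq_add2r.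
Qed.

Theorem proposition8 (k : nat) (hk : 0 < k) :
  [/\ c12 k 1 = 1,
      c12 k 2 = k + 1
    & forall n : nat, 3 <= n ->
        c12 k n = k * c12 k (n - 1) + k * c12 k (n - 2)]
  /\
  [/\ codd k 1 = 1,
      codd k 2 = k
    & forall n : nat, 3 <= n ->
        codd k n = k * codd k (n - 1) + codd k (n - 2)]
  /\
  [/\ cno1 k 2 = 1,
      cno1 k 3 = 1
    & forall n : nat, 4 <= n ->
        cno1 k n = cno1 k (n - 1) + k * cno1 k (n - 2)].
Proof.
rewrite /c12 /codd /cno1; set p12 := fun c => _ || _; set p1 := fun c => c != 1.
have one p : kcount p k 1 = p 1 by rewrite kcount_rec // big_geq // muln0 addn0.
have two p : kcount p k 2 = p 2 + k * (p 1 * p 1).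
  by rewrite kcount_rec // big_ltn_cond // big_geq // one; case: (p 1).
split; [|split]; split; rewrite ?one ?two ?muln1 ?muln0 // 1?addnC //.
- move=> [|[|[|n]]] // _; rewrite kcount_rec // -mulnDr; congr (_ * _).
  rewrite big_ltn_cond // big_ltn_cond //= big_nat_cond big_pred0 ?addn0 //.
  by move=> [|[|[|a]]] //=; rewrite andbF.
- move=> [|[|[|n]]] // _; rewrite kcount_rec // !subSS subn0.
  rewrite [kcount odd k n.+1]kcount_rec // big_ltn_cond // big_ltn_cond //=.
  (* A last part [a >= 3] of a composition of [n] is matched with the last part
     [a - 2] of a composition of [n - 2]: both leave the same sum. *)
  rewrite (big_addn 1 _ 2) /= !subSS !subn0 negbK mulnDr addnCA.
  congr (_ + (_ + k * _)).
  by apply: eq_big => [a|a _]; rewrite addn2 ?subSS //= negbK.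
- by rewrite kcount_rec // big_ltn_cond //= big_ltn_cond //= big_geq // one muln0.
- move=> [|[|[|[|n]]]] // _; rewrite kcount_rec // !subSS subn0.
  rewrite [kcount p1 k n.+3]kcount_rec // !(@big_ltn_cond _ _ _ 1) //=.
  rewrite (@big_ltn_cond _ _ _ 2) //=.
  (* Here a last part [a >= 3] of a composition of [n] is matched with the last
     part [a - 1] of a composition of [n - 1]. *)
  rewrite (big_addn 2 _ 1) /= !subSS !subn0 mulnDr -addnA [k * _ + _]addnC.
  congr (_ + (k * _ + _)); rewrite [LHS]big_nat_cond [RHS]big_nat_cond.
  by apply: eq_big => [[|[|a]]|a _] //; rewrite addn1.
Qed.
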